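(* Fix $(\alpha,\beta,\theta)\in(0,1)^3$ with $\alpha>\eta^{hyp}_\theta(\beta)$. Consider testing $H_0^{(p)}$: $X_i\stackrel{iid}{\sim}N(0,I_p)$, $1\le i\le n$, against $H_1^{(p)}$: the $X_i$'s are generated from the ARW model with parameters $(\alpha,\beta,\theta)$. For any test $\hat T=\hat T(X)$, $\mathrm{Err}(\hat T,\alpha,\beta,\theta)\gtrsim1$ as $p\to\infty$, i.e. $\liminf_{p\to\infty}\mathrm{Err}(\hat T,\alpha,\beta,\theta)\ge1$.
   Context: ARW model. For each $p$ let $n=n_p=p^\theta$ (treated as an integer), $\epsilon_p=p^{-\beta}$, $\tau_p=p^{-\alpha}$. The labels $\ell_1,\dots,\ell_n$ are i.i.d. uniform on $\{-1,1\}$; the coordinates of $\mu\in\mathbb R^p$ are i.i.d., equal to $\tau_p$ with probability $\epsilon_p$ and to $0$ with probability $1-\epsilon_p$; $Z_1,\dots,Z_n$ are i.i.d. $N(0,I_p)$; all are independent; $X_i=\ell_i\mu+Z_i$, $1\le i\le n$, are the rows of $X\in\mathbb R^{n\times p}$. Testing error. $\mathrm{Err}(\hat T,\alpha,\beta,\theta)=P_{H_0^{(p)}}(\hat T\text{ rejects }H_0^{(p)})+P_{H_1^{(p)}}(\hat T\text{ accepts }H_0^{(p)})$, with probabilities over $(\ell,\mu,Z)$. The curve: $\eta^{hyp}_\theta(\beta)=\max\{\eta^{hyp,1}_\theta(\beta),\eta^{hyp,2}_\theta(\beta)\}$ with $\eta^{hyp,1}_\theta(\beta)=(2+\theta-4\beta)/4$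 and $\eta^{hyp,2}_\theta(\beta)=\min\{\theta/2,(1+\theta-\beta)/4\}$. *)

(* Defs.v *)
From HB Require Import structures.
From mathcomp Require Import all_boot all_order all_algebra.
From mathcomp Require Import all_classical all_reals all_analysis.

Set Implicit Arguments.
Unset Strict Implicit.
Unset Printing Implicit Defensive.
Import Order.TTheory GRing.Theory Num.Theory.
Import numFieldNormedType.Exports.

Local Open Scope classical_set_scope.
Local Open Scope ring_scope.

Definition eta_hyp1 (R : realType) (theta beta : R) : R :=
  (2 + theta - 4 * beta) / 4.

Definition eta_hyp2 (R : realType) (theta beta : R) : R :=
  Num.min (theta / 2) ((1 + theta - beta) / 4).

Definition eta_hyp (R : realType) (theta beta : R) : R :=
  Num.max (eta_hyp1 theta beta) (eta_hyp2 theta beta).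

(* [p ^ theta] is rounded down to an integer. *)
Definition sample_size (R : realType) (theta : R) (p : nat) : nat :=
  Num.truncn (p%:R `^ theta).

Definition sparsity (R : realType) (beta : R) (p : nat) : R := p%:R `^ (- beta).

Definition strength (R : realType) (alpha : R) (p : nat) : R :=
  p%:R `^ (- alpha).

(* Mutual independence: the product rule holds on every subfamily. *)
Definition mutually_independent (d : measure_display) (Om : measurableType d)
    (R : realType) (P : probability Om R) (I : finType) (X : I -> Om -> R) :=
  forall (J : {set I}) (A : I -> set R), (forall i, measurable (A i)) ->
    P (\bigcap_(i in [set i | i \in J]) (X i @^-1` A i)) =
    (\prod_(i in J) P (X i @^-1` A i))%E.

(* The two measures are compared on Borel sets only: their values as functions
   on all sets are not meaningful elsewhere. *)
Definition is_std_normal (d : measure_display) (Om : measurableType d)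
    (R : realType) (P : probability Om R) (X : {RV P >-> R}) :=
  forall A : set R, measurable A -> distribution P X A = normal_prob 0 1 A.

(* The rows [X i] are i.i.d. N(0, I_p): all n * p coordinates are independent
   standard normal variables. *)
Definition iid_std_normal_rows (d : measure_display) (Om : measurableType d)
    (R : realType) (P : probability Om R) (n p : nat)
    (X : 'I_n -> 'I_p -> {RV P >-> R}) :=
  mutually_independent P
    (fun ij : 'I_n * 'I_p => X ij.1 ij.2 : Om -> R) /\
  forall i j, is_std_normal (X i j).

Definition all_vars (Om : Type) (R : realType) (n p : nat)
    (ell : 'I_n -> Om -> R) (mu : 'I_p -> Om -> R)
    (Z : 'I_n -> 'I_p -> Om -> R) (k : ('I_n + 'I_p) + ('I_n * 'I_p)) :
    Om -> R :=
  match k with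
  | inl (inl i) => ell i
  | inl (inr j) => mu j
  | inr ij => Z ij.1 ij.2
  end.

Record ARW_model (d : measure_display) (Om : measurableType d)
    (R : realType) (P : probability Om R) (n p : nat) (eps tau : R)
    (ell : 'I_n -> {RV P >-> R}) (mu : 'I_p -> {RV P >-> R})
    (Z : 'I_n -> 'I_p -> {RV P >-> R}) : Prop := {
  ARW_label_pos : forall i, P (ell i @^-1` [set 1]) = (2^-1)%:E ;
  ARW_label_neg : forall i, P (ell i @^-1` [set -1]) = (2^-1)%:E ;
  ARW_mean_tau : forall j, P (mu j @^-1` [set tau]) = eps%:E ;
  ARW_mean_0 : forall j, P (mu j @^-1` [set 0]) = (1 - eps)%:E ;
  ARW_noise : forall i j, is_std_normal (Z i j) ;
  ARW_indep : mutually_independent P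
    (all_vars (fun i => ell i : Om -> R) (fun j => mu j : Om -> R)
              (fun i j => Z i j : Om -> R)) }.

(* An n x p data matrix, as the tuple of its rows, with the product
   sigma-algebra. *)
Notation dataset R n p := (n.-tuple (p.-tuple R)).

Definition data_of (Om : Type) (R : realType) (n p : nat)
    (X : 'I_n -> 'I_p -> Om -> R) (w : Om) : dataset R n p :=
  [tuple [tuple X i j w | j < p] | i < n].

Definition ARW_data (Om : Type) (R : realType) (n p : nat)
    (ell : 'I_n -> Om -> R) (mu : 'I_p -> Om -> R)
    (Z : 'I_n -> 'I_p -> Om -> R) : Om -> dataset R n p :=
  data_of (fun i j w => ell i w * mu j w + Z i j w).

(* A test is a measurable function of the data; the value [true] means that the
   null hypothesis is rejected. *)
Definition testing_error (R : realType) (n p : nat)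
    (d0 d1 : measure_display)
    (Om0 : measurableType d0) (P0 : probability Om0 R)
    (data0 : Om0 -> dataset R n p)
    (Om1 : measurableType d1) (P1 : probability Om1 R)
    (data1 : Om1 -> dataset R n p)
    (T : {mfun dataset R n p >-> bool}) : \bar R :=
  (P0 [set w | T (data0 w) = true] + P1 [set w | T (data1 w) = false])%E.

(* Main.v *)
(* Second moment method with truncation. Conditionally on the labels and the
   signal, the alternative is a Gaussian shift of the null, so the likelihood
   ratio is explicit. Restrict the prior to signals with at most K = e p eps
   nonzero coordinates, an event of probability tending to 1, and let L be the
   resulting (sub-)likelihood ratio. Averaging over the labels gives
     E L^2 = E [cosh (tau^2 B)^n; A, A'],
   where B is the overlap of the supports of two independent signals and A, A'
   are the two truncation events. Put M = e^2 p eps^2 + p^gamma. Overlaps B <= M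
   contribute at most exp (2 n tau^4 M^2), which tends to 1 because
   alpha > eta^{hyp,1}. For B > M, either n tau^2 <= 1 (when alpha > theta / 2)
   or n tau^4 K -> 0 (when alpha > (1 + theta - beta) / 4), so that
   cosh (tau^2 B)^n <= e^B <= e^(2 B - M), whose expectation tends to 0. Hence
   E (L - 1)^2 -> 0, and Err >= 1 - sqrt (E (L - 1)^2). *)

Require Import Defs.
From HB Require Import structures.
From mathcomp Require Import all_boot all_order all_algebra.
From mathcomp Require Import all_classical all_reals all_analysis.
From mathcomp Require Import measurable_realfun.
From mathcomp Require Import ring lra.

Set Implicit Arguments.
Unset Strict Implicit.
Unset Printing Implicit Defensive.
Import Order.TTheory GRing.Theory Num.Theory.
Import numFieldNormedType.Exports.

Local Open Scope classical_set_scope.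
Local Open Scope ring_scope.

(** * Integration against a density and independence *)

Section density.
Local Open Scope ereal_scope.
Context d1 d2 (T1 : measurableType d1) (T2 : measurableType d2) (R : realType).
Variables (mu : {measure set T1 -> \bar R}) (nu : {measure set T2 -> \bar R}).
Variables (X : T1 -> T2) (g : T1 -> R).
Hypotheses (mX : measurable_fun setT X) (mg : measurable_fun setT g).
Hypothesis g0 : forall x, (0 <= g x)%R.
Hypothesis nuE : forall A, measurable A ->
  \int[mu]_(x in X @^-1` A) (g x)%:E = nu A.

Import HBNNSimple.

(** The hypothesis on [nu] is the identity for indicators. It passes to simple functions by
    linearity and to [f] by monotone convergence. It serves both for independence and for the
    Gaussian density. *)
Lemma ge0_integral_density (f : T2 -> \bar R) :
  measurable_fun setT f -> (forall y, 0 <= f y) ->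
  \int[mu]_x (f (X x) * (g x)%:E) = \int[nu]_y f y.
Proof.
move=> mf f0.
pose h := nnsfun_approx measurableT mf.
have cvgh y : (EFin \o h n) y @[n --> \oo] --> f y by exact: cvg_nnsfun_approx.
have mhX n : measurable_fun setT (h n \o X) by exact: measurableT_comp.
have -> : \int[nu]_y f y = lim (\int[nu]_y (EFin \o h n) y @[n --> \oo]).
  have fE y : f y = lim ((EFin \o h n) y @[n --> \oo]).
    by apply/esym/cvg_lim => //; exact: cvgh.
  under eq_integral do rewrite fE.
  apply: monotone_convergence => //.
  - by move=> n; apply/measurable_EFinP.
  - by move=> n y _; rewrite /= lee_fin.
  - by move=> y _ a b ab; rewrite lee_fin; exact/lefP/nd_nnsfun_approx.
have -> : \int[mu]_x (f (X x) * (g x)%:E) =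
    lim (\int[mu]_x ((EFin \o h n) (X x) * (g x)%:E) @[n --> \oo]).
  have fg x : f (X x) * (g x)%:E =
      lim ((EFin \o h n) (X x) * (g x)%:E @[n --> \oo]).
    by apply/esym/cvg_lim => //; apply: cvgeZr => //; exact: cvgh.
  under eq_integral do rewrite fg.
  apply: monotone_convergence => //.
  - move=> n; apply: emeasurable_funM; last exact/measurable_EFinP.
    by apply/measurable_EFinP; exact: mhX.
  - by move=> n x _ /=; rewrite mule_ge0 ?lee_fin.
  - move=> x _ a b ab/=; rewrite lee_wpmul2r ?lee_fin//.
    exact/lefP/nd_nnsfun_approx.
(* It remains to treat one simple function, split along its finite range. *)
congr (lim _); apply: (congr1 (fun u => u @ \oo)); apply/funext => n.
have mY y : measurable (X @^-1` (h n @^-1` [set y])).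
  by rewrite -[X in measurable X]setTI; exact: mX.
have mind r : measurable_fun setT
    (fun x => \1_(h n @^-1` [set r]) (X x) : R).
  by apply: measurableT_comp => //; exact: measurable_indic.
transitivity (\int[nu]_y
   (\sum_(r \in range (h n)) (r * \1_(h n @^-1` [set r]) y)%:E)); last first.
  by apply: eq_integral => t _; rewrite /= fimfunE -fsumEFin.
rewrite ge0_integral_fsum//; last 2 first.
- by move=> r; apply/measurable_EFinP; exact: measurable_funM.
- by move=> m y _; exact: nnfun_muleindic_ge0.
transitivity (\int[mu]_x (\sum_(r \in range (h n))
    (r * \1_(h n @^-1` [set r]) (X x))%:E * (g x)%:E)).
  apply: eq_integral => x _.
  rewrite -ge0_mule_fsuml => [|y]; last exact: nnfun_muleindic_ge0.
  by rewrite fsumEFin // -(fimfunE _ (X x)).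
rewrite ge0_integral_fsum//; last 2 first.
- move=> r; apply/emeasurable_funM; last exact/measurable_EFinP.
  by apply/measurable_EFinP; exact: measurable_funM.
- move=> m x _; rewrite mule_ge0 ?lee_fin//.
  by have := nnfun_muleindic_ge0 (h n) m (X x); rewrite lee_fin.
apply: eq_fsbigr => r rhn.
have r0 : (0 <= r)%R by move: rhn; rewrite inE => -[t _ <-].
under eq_integral do rewrite EFinM -muleA.
rewrite ge0_integralZl//; last 2 first.
- apply: emeasurable_funM; last exact/measurable_EFinP.
  by apply/measurable_EFinP; exact: mind.
- by move=> t _; rewrite mule_ge0 ?lee_fin.
under [RHS]eq_integral do rewrite EFinM.
rewrite ge0_integralZl//; last first.
- by apply/measurable_EFinP; exact: measurable_indic.
rewrite integral_indic// setIT -nuE//; congr (_ * _).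
rewrite [RHS]integral_mkcond; apply: eq_integral => x _.
by rewrite epatch_indic muleC.
Qed.

End density.

Section independence.
Context d (Om : measurableType d) (R : realType) (P : probability Om R).
Context (I : finType) (Y : I -> {RV P >-> R}).
Hypothesis indY : mutually_independent P (fun i => Y i : Om -> R).

(* The factors are replaced one at a time, starting from indicators: with all
   the other factors fixed, both sides are measures in the remaining one. *)
Lemma independent_integral_prod (f : I -> R -> R) :
  (forall i, measurable_fun setT (f i)) -> (forall i x, 0 <= f i x) ->
  (forall i, (\int[P]_w (f i (Y i w))%:E < +oo)%E) ->
  (\int[P]_w (\prod_i f i (Y i w))%:E = \prod_i \int[P]_w (f i (Y i w))%:E)%E.
Proof.
have mYA i A : measurable A -> measurable (Y i @^-1` A).
  by move=> mA; rewrite -[X in measurable X]setTI; exact: measurable_funP.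
have Iind i A : measurable A ->
    (\int[P]_w (\1_A (Y i w))%:E = P (Y i @^-1` A))%E.
  move=> mA; transitivity (\int[P]_w (\1_(Y i @^-1` A) w)%:E)%E => //.
  by rewrite integral_indic ?setIT//; exact: mYA.
(* The list [s] holds the indices whose factor is still arbitrary; off [s] the factors are
   indicators. For empty [s] the product is the indicator of an intersection, and independence
   applies directly. *)
suff H (s : seq I) : forall f : I -> R -> R,
    (forall i, measurable_fun setT (f i)) -> (forall i x, 0 <= f i x) ->
    (forall i, (\int[P]_w (f i (Y i w))%:E < +oo)%E) ->
    (forall i, i \notin s -> exists2 A, measurable A & f i = \1_A) ->
    (\int[P]_w (\prod_i f i (Y i w))%:E =
     \prod_i \int[P]_w (f i (Y i w))%:E)%E.
  move=> mf f0 foo; apply: (H (index_enum I)) => // i.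
  by rewrite mem_index_enum.
elim: s => [|a s IH] {}f mf f0 foo fs.
  have /choice[A AP] : forall i, exists A, measurable A /\ f i = \1_A.
    by move=> i; have [//|A mA fA] := fs i _; exists A.
  transitivity (\int[P]_w (\1_(\bigcap_(i in [set i | i \in [set: I]%SET])
      (Y i @^-1` A i)) w)%:E)%E.
    apply: eq_integral => w _; congr (_%:E).
    under eq_bigr => i _ do rewrite (AP i).2.
    rewrite [RHS]indicE; set B := \bigcap_(i in _) _.
    have [wA|] := pselect (B w).
    - rewrite mem_set//; apply: big1 => i _.
      by rewrite indicE mem_set//; apply: wA; rewrite /= inE.
    - move=> nB; rewrite memNset//; move: nB.
      move=> /existsNP[i] /not_implyP[_ nA].
      by rewrite (bigD1 i)//= indicE memNset// mul0r.
  rewrite integral_indic ?setIT//; last first.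
    apply: fin_bigcap_measurable => [|i _]; first exact: finite_finset.
    by apply: mYA; case: (AP i).
  rewrite [LHS](indY [set: I]%SET (fun i => (AP i).1)).
  under eq_bigl do rewrite inE.
  by apply: eq_bigr => i _; have [mA ->] := AP i; rewrite Iind.
(* With [g] the product of the factors other than [a], the image under [Y a] of the measure with
   density [g] is [c] times the law of [Y a]. This is the induction hypothesis with [f a] replaced
   by an indicator; [c] is finite, hence a legitimate scaling factor. *)
pose c := (\prod_(i | i != a) \int[P]_w (f i (Y i w))%:E)%E.
have c0 : (0 <= c)%E.
  by apply: prode_ge0 => i _; apply: integral_ge0 => w _; rewrite lee_fin.
have cfin : c \is a fin_num.
  apply/prode_fin_num => i _; rewrite ge0_fin_numE//.
  by apply: integral_ge0 => w _; rewrite lee_fin.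
have fc0 : 0 <= fine c by exact: fine_ge0.
pose g w := \prod_(i | i != a) f i (Y i w).
have mfY i : measurable_fun setT (fun w => f i (Y i w)).
  exact: measurableT_comp.
have mg : measurable_fun setT g.
  have -> : g =
      fun w => \prod_(i <- [seq i <- index_enum I | i != a]) f i (Y i w).
    by apply/funext => w; rewrite big_filter.
  exact: measurable_prod.
have g0 w : 0 <= g w by exact: prodr_ge0.
transitivity (\int[P]_w ((f a (Y a w))%:E * (g w)%:E))%E.
  by apply: eq_integral => w _; rewrite (bigD1 a)//= EFinM.
rewrite (@ge0_integral_density _ _ _ _ _ P
   (mscale (NngNum fc0) (distribution P (Y a))) (Y a) g _ mg g0 _
   (fun x => (f a x)%:E)) => //; last first.
- by move=> y; rewrite lee_fin.
- exact/measurable_EFinP.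
- move=> A mA.
  pose f' i := if i == a then \1_A : R -> R else f i.
  have f'a : f' a = \1_A by rewrite /f' eqxx.
  have f'n i : i != a -> f' i = f i by rewrite /f' => /negbTE ->.
  transitivity (\int[P]_w (\prod_i f' i (Y i w))%:E)%E.
    rewrite integral_mkcond; apply: eq_integral => w _.
    rewrite (bigD1 a)//= f'a EFinM epatch_indic muleC; congr (_ * _%:E)%E.
    by apply: eq_bigr => i /f'n ->.
  rewrite IH.
  + rewrite (bigD1 a)//= f'a Iind// muleC/= /mscale/= fineK//; congr (_ * _)%E.
    by apply: eq_bigr => i /f'n ->.
  + by move=> i; rewrite /f'; case: eqP => // _; exact: measurable_indic.
  + by move=> i x; rewrite /f'; case: eqP.
  + move=> i; rewrite /f'; case: eqP => [->|//].
    rewrite Iind//; apply: le_lt_trans (probability_le1 _ _) (ltry _).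
    exact: mYA.
  + move=> i si; have [->|ia] := eqVneq i a; first by exists A.
    by rewrite f'n//; apply: fs; rewrite inE negb_or ia.
have mfa : measurable_fun setT (EFin \o f a) by exact/measurable_EFinP.
rewrite (ge0_integral_mscale _ measurableT _ mfa)//; last first.
  by move=> x _; rewrite lee_fin.
rewrite (bigD1 a)//= muleC fineK// ge0_integral_distribution//.
by move=> y; rewrite lee_fin.
Qed.

End independence.

(** * Gaussian shifts and the law of the data *)

Section gaussian_shift.
Context (R : realType).
Local Notation leb := (@lebesgue_measure R).

Lemma lebesgue_measure_translation (m : R) (A : set R) : measurable A ->
  pushforward leb (+%R m : _ -> measurableTypeR R) A = leb A.
Proof.
move=> mA; apply/esym.
apply: (@lebesgue_measure_unique _
  (pushforward leb (+%R m : _ -> measurableTypeR R))) => //=.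
  exact: measurable_funD.
move=> mm _ [[a b] _ <-].
rewrite /pushforward/=.
have -> : +%R m @^-1` `]a, b] = `](a - m), (b - m)]%classic.
  by apply/seteqP; split => x /=; rewrite !in_itv/= ltrBlDl lerBrDl.
rewrite !lebesgue_measure_itv/= !lte_fin ltrD2r.
by case: ifPn => // _; rewrite -!EFinD; congr (_%:E); ring.
Qed.

Lemma normal_pdf1E (m x : R) :
  normal_pdf m 1 x = normal_peak 1 * expR (- (x - m) ^+ 2 / 2).
Proof. by rewrite normal_pdfE ?oner_eq0//= /normal_fun expr1n. Qed.

Lemma normal_prob_translation (m : R) (A : set R) : measurable A ->
  normal_prob 0 1 ((fun x => m + x) @^-1` A) = normal_prob m 1 A.
Proof.
move=> mA; rewrite /normal_prob.
transitivity (\int[pushforward leb (+%R m : _ -> measurableTypeR R)]_(x in A)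
    (normal_pdf m 1 x)%:E)%E; last first.
  apply: eq_measure_integral => [|mm B mB _]; first exact: measurable_funD.
  exact: lebesgue_measure_translation.
rewrite ge0_integral_pushforward//.
- apply: eq_integral => x _ /=.
  by rewrite !normal_pdf1E subr0 addrAC subrr add0r.
- exact: measurable_funD.
- by apply/measurable_EFinP/measurable_funTS; exact: measurable_normal_pdf.
- by move=> y _; rewrite lee_fin normal_pdf_ge0.
Qed.

Lemma measurable_tilt (c : R) (A : set R) : measurable A ->
  measurable_fun setT (fun x => expR (c * x - c ^+ 2 / 2) * \1_A x).
Proof.
move=> mA; apply: measurable_funM; last exact: measurable_indic.
by apply: measurableT_comp => //; apply: measurable_funB.
Qed.

(** Completing the square: the exponential factor is the density of N(c, 1) relative to N(0, 1). The
    measure [nu] is general because the law of a variable is known to be normal on Borel sets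
    only. *)
Lemma integral_normal_tilt (nu : {measure set R -> \bar R}) (c : R)
    (A : set R) :
  (forall B, measurable B -> nu B = normal_prob 0 1 B) -> measurable A ->
  (\int[nu]_x (expR (c * x - c ^+ 2 / 2) * \1_A x)%:E = normal_prob c 1 A)%E.
Proof.
move=> nuE mA.
rewrite -(@ge0_integral_density _ _ _ _ _ leb nu (id : measurableTypeR R -> R)
  (normal_pdf 0 1) _ _ _ _
  (fun x => (expR (c * x - c ^+ 2 / 2) * \1_A x)%:E)) => //.
- rewrite [RHS]integral_mkcond; apply: eq_integral => x _.
  rewrite epatch_indic -!EFinM !normal_pdf1E subr0; congr (_%:E).
  have -> : expR (- (x - c) ^+ 2 / 2) =
      expR (c * x - c ^+ 2 / 2) * expR (- x ^+ 2 / 2).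
    by rewrite -expRD; congr expR; field.
  by ring.
- exact: measurable_normal_pdf.
- by move=> x; exact: normal_pdf_ge0.
- by move=> B mB; rewrite nuE.
- by apply/measurable_EFinP; exact: measurable_tilt.
Qed.

End gaussian_shift.

Section density_measure.
Local Open Scope ereal_scope.
Context d1 d2 (T1 : measurableType d1) (T2 : measurableType d2) (R : realType).
Variables (mu : {measure set T1 -> \bar R}) (X : T1 -> T2) (g : T1 -> R).
Hypotheses (mX : measurable_fun setT X) (mg : measurable_fun setT g).
Hypothesis g0 : forall x, (0 <= g x)%R.

Let nu A := \int[mu]_(x in X @^-1` A) (g x)%:E.

Let nu0 : nu set0 = 0.
Proof. by rewrite /nu preimage_set0 integral_set0. Qed.

Let nu_ge0 A : 0 <= nu A.
Proof. by apply: integral_ge0 => x _; rewrite lee_fin. Qed.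

Let nu_sigma_additive : semi_sigma_additive nu.
Proof.
move=> F mF tF mUF; rewrite /nu preimage_bigcup ge0_integral_bigcup//.
- by apply: is_cvg_ereal_nneg_natsum_cond => n _ _; exact: nu_ge0.
- by move=> i; rewrite -[X in measurable X]setTI; exact: mX.
- exact/measurable_EFinP/measurable_funTS.
- by move=> x _; rewrite lee_fin.
- apply/trivIsetP => /= i j _ _ ij; rewrite -preimage_setI.
  by move/trivIsetP : tF => /(_ _ _ _ _ ij) ->//; rewrite preimage_set0.
Qed.

(** Packages the integral as a measure in [A], so that uniqueness of measures can be applied to the
    law of the data. *)
Lemma density_measure : exists nu : {measure set T2 -> \bar R},
  forall A, nu A = \int[mu]_(x in X @^-1` A) (g x)%:E.
Proof.
pose nuM := isMeasure.Build _ _ _ nu nu0 nu_ge0 nu_sigma_additive.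
pose nu' : {measure set T2 -> \bar R} := HB.pack nu nuM.
by exists nu'.
Qed.

End density_measure.

(** * Rectangles and uniqueness of measures on data matrices *)

Definition rectangle (R : realType) (n p : nat) (B : 'I_n -> 'I_p -> set R) :
    set (dataset R n p) :=
  [set x | forall i j, B i j (tnth (tnth x i) j)].

Section rectangles.
Context (R : realType) (n p : nat).
Local Notation D := (dataset R n p).

Let rects : set (set D) :=
  [set A | exists2 B : 'I_n -> 'I_p -> set R,
     (forall i j, measurable (B i j)) & A = rectangle B].

Lemma measurable_rectangle (B : 'I_n -> 'I_p -> set R) :
  (forall i j, measurable (B i j)) -> measurable (rectangle B).
Proof.
move=> mB.
have -> : rectangle B = \bigcap_(i in [set: 'I_n]) \bigcap_(j in [set: 'I_p])
    ((fun x : D => tnth (tnth x i) j) @^-1` B i j).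
  by apply/seteqP; split => x Bx i; [move=> _ j _|move=> j]; apply: Bx.
apply: fin_bigcap_measurable => [|i _]; first exact: finite_finset.
apply: fin_bigcap_measurable => [|j _]; first exact: finite_finset.
rewrite -[X in measurable X]setTI.
have : measurable_fun setT (fun x : D => tnth (tnth x i) j).
  apply: (@measurableT_comp _ _ _ _ _ _ (fun y : p.-tuple R => tnth y j)).
    exact: measurable_tnth.
  exact: measurable_tnth.
exact.
Qed.

(** Each coordinate map is measurable for the generated sigma-algebra: the preimage of [A] is the
    rectangle with [A] at one entry and [setT] elsewhere. *)
Let rects_generate : (@measurable _ D) `<=` <<s rects >>.
Proof.
have mid : measurable_fun [set: g_sigma_algebraType rects] (id : _ -> D).
  apply/measurable_fun_tnthP => i; apply/measurable_fun_tnthP => j.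
  move=> _ A mA; rewrite setTI; apply: sub_sigma_algebra.
  exists (fun i' j' => if (i' == i) && (j' == j) then A else setT).
    by move=> i' j'; case: ifP.
  apply/seteqP; split => x /=.
    by move=> Ax i' j'; case: ifP => // /andP[/eqP -> /eqP ->].
  by move=> /(_ i j); rewrite !eqxx.
by move=> A mA; have := mid measurableT A mA; rewrite setTI.
Qed.

(** Rectangles form a generating class stable under intersection. The full space is itself a
    rectangle of finite mass, so a constant exhausting sequence is enough. *)
Lemma dataset_measure_unique (m1 m2 : {measure set D -> \bar R}) :
  (m1 setT < +oo)%E ->
  (forall B, (forall i j, measurable (B i j)) ->
     m1 (rectangle B) = m2 (rectangle B)) ->
  forall A, measurable A -> m1 A = m2 A.
Proof.
move=> m1oo m12 A mA.
apply: (g_sigma_algebra_measure_unique rects _ (fun=> setT)) => //.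
- by move=> _ [B mB ->]; exact: measurable_rectangle.
- by move=> _; exists (fun _ _ => setT) => //; apply/seteqP; split.
- by rewrite bigcup_const//; exists 0%N.
- move=> _ _ [B mB ->] [C mC ->]; exists (fun i j => B i j `&` C i j).
    by move=> i j; exact: measurableI.
  apply/seteqP; split => x /=; first by move=> [Bx Cx] i j; split.
  by move=> BCx; split => i j; have [] := BCx i j.
- by move=> _ [B mB ->]; exact: m12.
- exact: rects_generate.
Qed.

End rectangles.

(** * Likelihood ratio of N(c, I) against N(0, I) *)

Definition likelihood_ratio (R : realType) (I : finType) (c x : I -> R) : R :=
  \prod_k expR (c k * x k - c k ^+ 2 / 2).

Section gaussian_family.
Context d (Om : measurableType d) (R : realType) (P : probability Om R).
Context (I : finType) (Y : I -> {RV P >-> R}).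
Hypothesis indY : mutually_independent P (fun k => Y k : Om -> R).
Hypothesis stdY : forall k, is_std_normal (Y k).

Lemma measurable_likelihood_ratio (c : I -> R) :
  measurable_fun setT (fun w => likelihood_ratio c (fun k => Y k w)).
Proof.
apply: measurable_prod => k _; apply: measurableT_comp => //.
by apply: measurable_funB => //; exact: measurable_funM.
Qed.

Lemma likelihood_ratio_ge0 (c x : I -> R) : 0 <= likelihood_ratio c x.
Proof. by apply: prodr_ge0 => k _; exact: expR_ge0. Qed.

Lemma integral_likelihood_ratio_rectangle (c : I -> R) (B : I -> set R) :
  (forall k, measurable (B k)) ->
  (\int[P]_(w in [set w | forall k, B k (Y k w)])
     (likelihood_ratio c (fun k => Y k w))%:E =
   \prod_k normal_prob (c k) 1 (B k))%E.
Proof.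
move=> mB.
have E k : (\int[P]_w (expR (c k * Y k w - c k ^+ 2 / 2) * \1_(B k) (Y k w))%:E
    = normal_prob (c k) 1 (B k))%E.
  rewrite -(integral_normal_tilt (nu := distribution P (Y k)) (c k) _ (mB k));
    last by move=> A mA; exact: stdY.
  have mf : measurable_fun setT
      (fun x => (expR (c k * x - c k ^+ 2 / 2) * \1_(B k) x)%:E).
    by apply/measurable_EFinP; exact: measurable_tilt.
  by rewrite ge0_integral_distribution// => x;
     rewrite lee_fin mulr_ge0 ?expR_ge0.
(* The indicator of the rectangle is distributed over the factors, so that each factor depends on
   one variable and independence applies. *)
transitivity (\int[P]_w (\prod_k
    (expR (c k * Y k w - c k ^+ 2 / 2) * \1_(B k) (Y k w)))%:E)%E.
  rewrite integral_mkcond; apply: eq_integral => w _.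
  rewrite big_split/= epatch_indic -EFinM; congr (_ * _)%:E.
  rewrite indicE; have [wA|nB] := pselect (forall k, B k (Y k w)).
    rewrite mem_set//; apply/esym/big1 => k _.
    by rewrite indicE mem_set//; exact: wA.
  rewrite memNset//; move: nB => /existsNP[k nB].
  by rewrite (bigD1 k)//= indicE memNset// mul0r.
rewrite (independent_integral_prod indY
  (f := fun k x => expR (c k * x - c k ^+ 2 / 2) * \1_(B k) x)).
- by apply: eq_bigr => k _; exact: E.
- by move=> k; exact: measurable_tilt.
- by move=> k x; rewrite mulr_ge0 ?expR_ge0.
- move=> k; rewrite E; apply: le_lt_trans (ltry 1).
  exact: (@probability_le1 _ _ _ (normal_prob (c k) 1) _ (mB k)).
Qed.

Lemma integral_likelihood_ratio (c : I -> R) :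
  (\int[P]_w (likelihood_ratio c (fun k => Y k w))%:E = 1)%E.
Proof.
have := @integral_likelihood_ratio_rectangle c (fun=> setT) (fun=> measurableT).
rewrite (_ : [set w | _] = setT); last by apply/seteqP; split.
move=> ->; apply: big1 => k _.
exact: (@probability_setT _ _ _ (normal_prob (c k) 1)).
Qed.

(** The product of the ratios at [c] and [c'] is the ratio at [c + c'] times the exponential of the
    inner product of [c] and [c'], and a likelihood ratio integrates to 1. *)
Lemma integral_likelihood_ratioM (c c' : I -> R) :
  (\int[P]_w (likelihood_ratio c (fun k => Y k w) *
              likelihood_ratio c' (fun k => Y k w))%:E =
   (expR (\sum_k c k * c' k))%:E)%E.
Proof.
transitivity (\int[P]_w ((expR (\sum_k c k * c' k))%:E *
   (likelihood_ratio (fun k => c k + c' k) (fun k => Y k w))%:E))%E.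
  apply: eq_integral => w _; rewrite -EFinM; congr (_%:E).
  rewrite -big_split/= expR_sum -big_split/=; apply: eq_bigr => k _.
  by rewrite -!expRD; congr expR; field.
rewrite ge0_integralZl//.
- by rewrite integral_likelihood_ratio mule1.
- exact/measurable_EFinP/measurable_likelihood_ratio.
- by move=> w _; rewrite lee_fin likelihood_ratio_ge0.
Qed.

End gaussian_family.

(** * Configurations of labels and signals *)

Definition label (R : realType) (b : bool) : R := if b then 1 else -1.

(* A configuration [(s, v)] encodes the labels [ell i = label (s i)] and the
   signal [mu j = if v j then tau else 0]; [arw_weight] is its probability and
   [arw_shift] the mean it gives to the data matrix. *)
Definition support_weight (R : realType) (eps : R) (p : nat)
    (v : {ffun 'I_p -> bool}) : R :=
  \prod_j (if v j then eps else 1 - eps).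

Definition arw_weight (R : realType) (eps : R) (n p : nat)
    (sv : {ffun 'I_n -> bool} * {ffun 'I_p -> bool}) : R :=
  2^-1 ^+ n * support_weight eps sv.2.

Definition arw_shift (R : realType) (tau : R) (n p : nat)
    (sv : {ffun 'I_n -> bool} * {ffun 'I_p -> bool}) (k : 'I_n * 'I_p) : R :=
  label R (sv.1 k.1) * (if sv.2 k.2 then tau else 0).

(** * Law of the data given the labels and the signal *)

Section arw_conditioning.
Context (R : realType) (n p : nat) (eps tau : R).
Context d0 (Om0 : measurableType d0) (P0 : probability Om0 R).
Context (X : 'I_n -> 'I_p -> {RV P0 >-> R}).
Hypothesis iidX : iid_std_normal_rows X.
Context d1 (Om1 : measurableType d1) (P1 : probability Om1 R).
Context (ell : 'I_n -> {RV P1 >-> R}) (mu : 'I_p -> {RV P1 >-> R}).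
Context (Z : 'I_n -> 'I_p -> {RV P1 >-> R}).
Hypothesis arw : ARW_model eps tau ell mu Z.
Local Notation config := ({ffun 'I_n -> bool} * {ffun 'I_p -> bool})%type.

Definition arw_event (sv : config) : set Om1 :=
  [set w | (forall i, ell i w = label R (sv.1 i)) /\
           (forall j, mu j w = if sv.2 j then tau else 0)].

Let LR (sv : config) (w : Om0) : R :=
  likelihood_ratio (arw_shift tau sv) (fun k => X k.1 k.2 w).

(** Once labels and signal are fixed, the data lie in [B] exactly when the noise lies in the
    translate of [B] by the shift. The whole event is thus a product cell, to which mutual
    independence applies. *)
Let arw_cell (sv : config) (B : 'I_n -> 'I_p -> set R)
    (k : ('I_n + 'I_p) + ('I_n * 'I_p)) : set R :=
  match k with
  | inl (inl i) => [set label R (sv.1 i)]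
  | inl (inr j) => [set if sv.2 j then tau else 0]
  | inr ij => (fun x => arw_shift tau sv ij + x) @^-1` B ij.1 ij.2
  end.

(** In the model [eps] and [1 - eps] are probabilities. *)
Lemma arw_weight_ge0 (sv : config) : 0 <= arw_weight eps sv.
Proof.
rewrite mulr_ge0 ?exprn_ge0 ?invr_ge0//; apply: prodr_ge0 => j _.
case: (sv.2 j); rewrite -lee_fin.
  by rewrite -(ARW_mean_tau arw j).
by rewrite -(ARW_mean_0 arw j).
Qed.

Lemma prob_arw_event_rectangle (sv : config) (B : 'I_n -> 'I_p -> set R) :
  (forall i j, measurable (B i j)) ->
  (P1 (arw_event sv `&` ARW_data ell mu Z @^-1` rectangle B) =
   (arw_weight eps sv)%:E *
   \prod_(k : 'I_n * 'I_p)
      normal_prob (arw_shift tau sv k) 1 (B k.1 k.2))%E.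
Proof.
move=> mB.
have mshift (c : R) : measurable_fun setT (fun x : R => c + x).
  exact: measurable_funD.
have mcell k : measurable (arw_cell sv B k).
  case: k => [[i|j]|[i j]]; [exact: measurable_set1|exact: measurable_set1|].
  by rewrite -[X in measurable X]setTI; exact: mshift.
have := ARW_indep arw [set: _]%SET mcell.
rewrite (_ : \bigcap_(i in _) _ =
    arw_event sv `&` ARW_data ell mu Z @^-1` rectangle B).
  move=> ->.
  rewrite (eq_bigl predT); last by move=> k; rewrite inE.
  rewrite big_sumType/= big_sumType/=; congr (_ * _)%E.
    rewrite /arw_weight EFinM -!prodEFin.
    rewrite -[X in _ ^+ X]card_ord -prodr_const -prodEFin.
    congr (_ * _)%E; apply: eq_bigr.
      move=> i _; rewrite /label; case: (sv.1 i).
        exact: (ARW_label_pos arw).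
      exact: (ARW_label_neg arw).
    move=> j _; case: (sv.2 j).
      exact: (ARW_mean_tau arw).
    exact: (ARW_mean_0 arw).
  apply: eq_bigr => -[i j] _ /=.
  rewrite -normal_prob_translation// -(ARW_noise arw i j)//.
  by rewrite -[X in measurable X]setTI; exact: mshift.
apply/seteqP; split => w /=.
  move=> Aw; split; first split.
  - by move=> i; have := Aw (inl (inl i)) (finset.in_setT _).
  - by move=> j; have := Aw (inl (inr j)) (finset.in_setT _).
  - move=> i j; rewrite /ARW_data /data_of !tnth_mktuple.
    have := Aw (inr (i, j)) (finset.in_setT _).
    have := Aw (inl (inl i)) (finset.in_setT _).
    have := Aw (inl (inr j)) (finset.in_setT _).
    by rewrite /= /arw_shift/= => -> ->.
move=> [[El Em] Bw] [[i|j]|[i j]] _ //=.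
have := Bw i j; rewrite /ARW_data /data_of !tnth_mktuple.
by rewrite El Em.
Qed.

Lemma measurable_arw_event (sv : config) : measurable (arw_event sv).
Proof.
have mpre d (Om : measurableType d) (P : probability Om R) (Y : {RV P >-> R})
    r : measurable (Y @^-1` [set r]).
  by rewrite -[X in measurable X]setTI; apply: measurable_funP => //;
     exact: measurable_set1.
rewrite (_ : arw_event sv =
    (\bigcap_(i in [set: 'I_n]) ell i @^-1` [set label R (sv.1 i)]) `&`
    (\bigcap_(j in [set: 'I_p]) mu j @^-1` [set if sv.2 j then tau else 0])).
  apply: measurableI; apply: fin_bigcap_measurable => *;
    by [exact: finite_finset|exact: mpre].
apply/seteqP; split => w /= -[El Em].
  by split=> i _; [exact: El|exact: Em].
by split=> i; [exact: El|exact: Em].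
Qed.

Lemma measurable_data_of d (Om : measurableType d)
    (Y : 'I_n -> 'I_p -> Om -> R) :
  (forall i j, measurable_fun setT (Y i j)) -> measurable_fun setT (data_of Y).
Proof.
move=> mY; apply/measurable_fun_tnthP => i; apply/measurable_fun_tnthP => j.
rewrite (_ : _ \o _ = Y i j)//.
by apply/funext => w; rewrite /data_of /= !tnth_mktuple.
Qed.

Let mdata0 : measurable_fun setT (data_of (fun i j => X i j : Om0 -> R)).
Proof. by apply: measurable_data_of => i j; exact: measurable_funP. Qed.

Lemma measurable_ARW_data : measurable_fun setT (ARW_data ell mu Z).
Proof.
apply: measurable_data_of => i j; apply: measurable_funD => //.
exact: measurable_funM.
Qed.

Let mLR sv : measurable_fun setT (LR sv).
Proof. exact: (measurable_likelihood_ratio (fun k => X k.1 k.2)). Qed.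

(** Both sides are finite measures in [C] that agree on rectangles. This carries the alternative
    over to the null space, where its law on a configuration has an explicit density. *)
Lemma prob_arw_event (sv : config) (C : set (dataset R n p)) : measurable C ->
  (P1 (arw_event sv `&` ARW_data ell mu Z @^-1` C) =
   \int[P0]_(w in data_of (fun i j => X i j : Om0 -> R) @^-1` C)
     (arw_weight eps sv * LR sv w)%:E)%E.
Proof.
move=> mC.
have mE := measurable_arw_event sv.
have mI : measurable_fun setT (\1_(arw_event sv) : Om1 -> R).
  exact: measurable_indic.
have I0 w : (0 <= \1_(arw_event sv) w :> R) by [].
have [nu1 nu1E] := density_measure P1 measurable_ARW_data mI I0.
have mg : measurable_fun setT (fun w => arw_weight eps sv * LR sv w).
  exact: measurable_funM.
have g0 w : 0 <= arw_weight eps sv * LR sv w.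
  by rewrite mulr_ge0 ?arw_weight_ge0 ?likelihood_ratio_ge0.
have [nu2 nu2E] := density_measure P0 mdata0 mg g0.
have nu1P A : measurable A ->
    nu1 A = P1 (arw_event sv `&` ARW_data ell mu Z @^-1` A).
  move=> mA; rewrite nu1E integral_indic//.
  by rewrite -[X in measurable X]setTI; exact: measurable_ARW_data.
rewrite -nu1P// -nu2E; apply: dataset_measure_unique => //.
  rewrite nu1P//; apply: le_lt_trans (ltry 1).
  apply: probability_le1; rewrite preimage_setT setIT//.
move=> B mB; rewrite nu1P; last exact: measurable_rectangle.
rewrite prob_arw_event_rectangle// nu2E.
under [RHS]eq_integral do rewrite EFinM.
have mR : measurable (data_of (fun i j => X i j : Om0 -> R) @^-1` rectangle B).
  by rewrite -[X in measurable X]setTI; apply: mdata0 => //;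
     exact: measurable_rectangle.
rewrite ge0_integralZl//; last 3 first.
- by apply/measurable_EFinP/measurable_funTS; exact: mLR.
- by move=> w _; rewrite lee_fin likelihood_ratio_ge0.
- by rewrite lee_fin arw_weight_ge0.
congr (_ * _)%E.
rewrite -(@integral_likelihood_ratio_rectangle _ _ _ P0 _
   (fun k : 'I_n * 'I_p => X k.1 k.2) iidX.1 (fun k => iidX.2 k.1 k.2)
   (arw_shift tau sv) (fun k => B k.1 k.2)) => [|k]; last exact: mB.
congr (integral _ _ _); apply/seteqP; split => w /= Bw.
  by move=> i j; rewrite /data_of !tnth_mktuple; exact: (Bw (i, j)).
by move=> [i j]; have := Bw i j; rewrite /data_of !tnth_mktuple.
Qed.

End arw_conditioning.

Lemma sum_measure_le d (T : measurableType d) (R : realType)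
    (mu : {measure set T -> \bar R}) (I : finType) (A : pred I)
    (F : I -> set T) (G : set T) :
  (forall i, measurable (F i)) -> measurable G -> (forall i, F i `<=` G) ->
  trivIset setT F -> (\sum_(i | A i) mu (F i) <= mu G)%E.
Proof.
move=> mF mG FG tF; rewrite -big_filter.
rewrite fsbig_seq; last by rewrite filter_uniq ?index_enum_uniq.
rewrite -measure_fin_bigcup//; last exact: sub_trivIset tF.
apply: le_measure; rewrite ?inE//.
- exact: fin_bigcup_measurable.
- by move=> x [i _ /FG].
Qed.

(** * Lower bound on the testing error by a truncated second moment *)

Section testing_lower_bound.
Context (R : realType) (n p : nat) (eps tau : R).
Context d0 (Om0 : measurableType d0) (P0 : probability Om0 R).
Context (X : 'I_n -> 'I_p -> {RV P0 >-> R}).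
Hypothesis iidX : iid_std_normal_rows X.
Context d1 (Om1 : measurableType d1) (P1 : probability Om1 R).
Context (ell : 'I_n -> {RV P1 >-> R}) (mu : 'I_p -> {RV P1 >-> R}).
Context (Z : 'I_n -> 'I_p -> {RV P1 >-> R}).
Hypothesis arw : ARW_model eps tau ell mu Z.
Hypothesis tau0 : tau != 0.
Local Notation config := ({ffun 'I_n -> bool} * {ffun 'I_p -> bool})%type.

(** A sample point determines its labels and, since [tau] is nonzero, its support. *)
Lemma trivIset_arw_event : trivIset setT (arw_event tau ell mu (p := p)).
Proof.
move=> [s v] [s' v'] _ _ [w [[/= El Em] [/= El' Em']]]; congr pair.
  apply/ffunP => i; move: (El i); rewrite (El' i) /label.
  by case: (s i); case: (s' i) => // ?; exfalso; lra.
apply/ffunP => j; move: (Em j); rewrite (Em' j).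
by case: (v j); case: (v' j) => // /eqP;
   rewrite ?(negbTE tau0)// eq_sym (negbTE tau0).
Qed.

(** The first moment of [L] under the null. *)
Definition config_mass (A : pred {ffun 'I_p -> bool}) : R :=
  \sum_(sv : config | A sv.2) arw_weight eps sv.

(** The second moment of [L] under the null; each exponential is the integral of a product of two
    likelihood ratios. *)
Definition config_energy (A : pred {ffun 'I_p -> bool}) : R :=
  \sum_(sv : config | A sv.2) \sum_(sv' : config | A sv'.2)
    arw_weight eps sv * arw_weight eps sv' *
    expR (\sum_k arw_shift tau sv k * arw_shift tau sv' k).

(* The likelihood ratio of the alternative, restricted to signals in [A]. *)
Let L (A : pred {ffun 'I_p -> bool}) (w : Om0) : R :=
  \sum_(sv : config | A sv.2) arw_weight eps sv *
    likelihood_ratio (arw_shift tau sv) (fun k => X k.1 k.2 w).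

Let term_ge0 (sv : config) (w : Om0) : 0 <= arw_weight eps sv *
    likelihood_ratio (arw_shift tau sv) (fun k => X k.1 k.2 w).
Proof. by rewrite mulr_ge0 ?(arw_weight_ge0 arw) ?likelihood_ratio_ge0. Qed.

Let mterm (sv : config) : measurable_fun setT (fun w => arw_weight eps sv *
    likelihood_ratio (arw_shift tau sv) (fun k => X k.1 k.2 w)).
Proof.
apply: measurable_funM => //.
exact: (measurable_likelihood_ratio (fun k => X k.1 k.2)).
Qed.

Let L_ge0 A w : 0 <= L A w.
Proof. by apply: sumr_ge0 => sv _; exact: term_ge0. Qed.

Let mL A : measurable_fun setT (L A).
Proof.
have -> : L A = fun w => \sum_(sv <- [seq sv <- index_enum config | A sv.2])
    arw_weight eps sv *
    likelihood_ratio (arw_shift tau sv) (fun k => X k.1 k.2 w).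
  by apply/funext => w; rewrite big_filter.
by apply: measurable_sum => sv; exact: mterm.
Qed.

Let integral_L A (D : set Om0) : measurable D ->
  (\int[P0]_(w in D) (L A w)%:E = \sum_(sv : config | A sv.2)
    \int[P0]_(w in D) (arw_weight eps sv *
      likelihood_ratio (arw_shift tau sv) (fun k => X k.1 k.2 w))%:E)%E.
Proof.
move=> mD; under eq_integral do rewrite -sumEFin -big_filter.
rewrite ge0_integral_sum ?big_filter//.
- by move=> sv; apply/measurable_EFinP/measurable_funTS; exact: mterm.
- by move=> sv w _; rewrite lee_fin term_ge0.
Qed.

Let integral_term sv : (\int[P0]_w (arw_weight eps sv *
      likelihood_ratio (arw_shift tau sv) (fun k => X k.1 k.2 w))%:E =
  (arw_weight eps sv)%:E)%E.
Proof.
under eq_integral do rewrite EFinM.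
rewrite ge0_integralZl//.
- by rewrite (integral_likelihood_ratio iidX.1 (fun k => iidX.2 k.1 k.2)) mule1.
- apply/measurable_EFinP.
  exact: (measurable_likelihood_ratio (fun k => X k.1 k.2)).
- by move=> w _; rewrite lee_fin likelihood_ratio_ge0.
- by rewrite lee_fin (arw_weight_ge0 arw).
Qed.

Let integral_LT A : (\int[P0]_w (L A w)%:E = (config_mass A)%:E)%E.
Proof.
by rewrite integral_L// -sumEFin; apply: eq_bigr => sv _; exact: integral_term.
Qed.

Let integral_L2 A : (\int[P0]_w (L A w ^+ 2)%:E = (config_energy A)%:E)%E.
Proof.
pose t sv w := arw_weight eps sv *
  likelihood_ratio (arw_shift tau sv) (fun k : 'I_n * 'I_p => X k.1 k.2 w).
transitivity (\int[P0]_w \sum_(sv <- [seq sv <- index_enum config | A sv.2])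
    \sum_(sv' <- [seq sv <- index_enum config | A sv.2])
    (t sv w * t sv' w)%:E)%E.
  apply: eq_integral => w _; rewrite big_filter expr2 /L mulr_suml -sumEFin.
  apply: eq_bigr => sv _; rewrite big_filter mulr_sumr -sumEFin.
  exact: eq_bigr.
have mtt sv sv' : measurable_fun setT (fun w => (t sv w * t sv' w)%:E).
  by apply/measurable_EFinP/measurable_funM; exact: mterm.
have tt0 sv sv' w : (0 <= (t sv w * t sv' w)%:E)%E.
  by rewrite lee_fin mulr_ge0//; exact: term_ge0.
rewrite ge0_integral_sum//; last 2 first.
- by move=> sv; exact: emeasurable_sum.
- by move=> sv w _; apply: sume_ge0 => sv' _; exact: tt0.
rewrite big_filter -sumEFin; apply: eq_bigr => sv _.
rewrite ge0_integral_sum// big_filter -sumEFin; apply: eq_bigr => sv' _.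
pose LR sv w :=
  likelihood_ratio (arw_shift tau sv) (fun k : 'I_n * 'I_p => X k.1 k.2 w).
transitivity (\int[P0]_w ((arw_weight eps sv * arw_weight eps sv')%:E *
    (LR sv w * LR sv' w)%:E))%E.
  by apply: eq_integral => w _; rewrite -EFinM mulrACA.
rewrite ge0_integralZl//.
- by rewrite (integral_likelihood_ratioM iidX.1 (fun k => iidX.2 k.1 k.2)).
- apply/measurable_EFinP/measurable_funM.
    exact: (measurable_likelihood_ratio (fun k => X k.1 k.2)).
  exact: (measurable_likelihood_ratio (fun k => X k.1 k.2)).
- by move=> w _; rewrite lee_fin mulr_ge0 ?likelihood_ratio_ge0.
- by rewrite lee_fin mulr_ge0 ?(arw_weight_ge0 arw).
Qed.

Variable T : {mfun dataset R n p >-> bool}.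
Local Notation data0 := (data_of (fun i j => X i j : Om0 -> R)).
Local Notation data1 := (ARW_data ell mu Z).

Let mT b : measurable (T @^-1` [set b]).
Proof. by rewrite -[X in measurable X]setTI; exact: measurable_funP. Qed.

Let mT0 b : measurable (data0 @^-1` (T @^-1` [set b])).
Proof.
rewrite -[X in measurable X]setTI.
by apply: (measurable_data_of (fun i j => measurable_funP (X i j))) => //.
Qed.

Let mT1 b : measurable (data1 @^-1` (T @^-1` [set b])).
Proof.
by rewrite -[X in measurable X]setTI; exact: (measurable_ARW_data ell mu Z).
Qed.

(* Only an inequality: [L] ignores the signals outside [A]. *)
Let integral_L_accept A :
  (\int[P0]_(w in data0 @^-1` (T @^-1` [set false])) (L A w)%:E <=
   P1 (data1 @^-1` (T @^-1` [set false])))%E.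
Proof.
rewrite integral_L//.
under eq_bigr => sv _ do rewrite -(prob_arw_event iidX arw)//.
apply: sum_measure_le => //.
- by move=> sv; apply: measurableI => //; exact: measurable_arw_event.
- exact: trivIset_setIr trivIset_arw_event.
Qed.

(* With [Err = P0(T = 1) + P1(T = 0)] this integrates the pointwise bound
   [2 eta (1_(T = 1) + L 1_(T = 0)) + L^2 + 1 + eta^2 >= 2 eta + 2 L]. *)
Lemma testing_error_ge (A : pred {ffun 'I_p -> bool}) (eta : R) : 0 < eta ->
  config_energy A - 2 * config_mass A + 1 <= eta ^+ 2 ->
  ((1 - eta)%:E <= testing_error P0 data0 P1 data1 T)%E.
Proof.
move=> eta0 energy_le.
set a := P0 (data0 @^-1` (T @^-1` [set true])).
set b := P1 (data1 @^-1` (T @^-1` [set false])).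
have -> : testing_error P0 data0 P1 data1 T = (a + b)%E by [].
have afin : a \is a fin_num by exact: fin_num_measure.
have bfin : b \is a fin_num by exact: fin_num_measure.
set S1 := data0 @^-1` (T @^-1` [set true]).
set S0 := data0 @^-1` (T @^-1` [set false]).
pose c := (\int[P0]_(w in S0) (L A w)%:E)%E.
have cb : (c <= b)%E by exact: integral_L_accept.
have c0 : (0 <= c)%E by apply: integral_ge0 => w _; rewrite lee_fin.
have cfin : c \is a fin_num.
  by rewrite ge0_fin_numE// (le_lt_trans cb)// ltey_eq bfin.
have icst (x : R) : (\int[P0]_w x%:E = x%:E)%E.
  by rewrite integral_cst// [X in (_ * X)%E]probability_setT mule1.
have mS1 : measurable S1 by exact: mT0.
have mS0 : measurable S0 by exact: mT0.
have mI : measurable_fun setT (\1_S1 : Om0 -> R) by exact: measurable_indic.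
have mI0 : measurable_fun setT (\1_S0 : Om0 -> R) by exact: measurable_indic.
have : (\int[P0]_w (2 * eta + 2 * L A w)%:E <=
        \int[P0]_w ((2 * eta * \1_S1 w) + (2 * eta * (L A w * \1_S0 w) +
           (L A w ^+ 2 + (1 + eta ^+ 2))))%:E)%E.
  apply: ge0_le_integral => //.
  - by move=> w _; rewrite lee_fin addr_ge0// mulr_ge0// ?L_ge0// ltW.
  - apply/measurable_EFinP; apply: measurable_funD => //.
    exact: measurable_funM.
  - apply/measurable_EFinP; apply: measurable_funD.
      exact: measurable_funM.
    apply: measurable_funD.
      by apply: measurable_funM => //; exact: measurable_funM.
    by apply: measurable_funD => //; exact: measurable_funX.
  - move=> w _; rewrite lee_fin !indicE.
    set l := L A w.
    (* The right side minus the left is [(l - 1) ^+ 2 + eta ^+ 2] on rejection and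
       [(l - 1 + eta) ^+ 2] on acceptance. *)
    have [Tw|/negbTE Tw] := boolP (T (data0 w)).
      rewrite mem_set// memNset; last by rewrite /S0 /= Tw.
      rewrite !mulr1 !mulr0; have := sqr_ge0 (l - 1); have := sqr_ge0 eta; nra.
    rewrite memNset; last by rewrite /S1 /= Tw.
    rewrite mem_set// !mulr1 !mulr0; have := sqr_ge0 (l - 1 + eta); nra.
have -> : (\int[P0]_w (2 * eta + 2 * L A w)%:E =
    (2 * eta + 2 * config_mass A)%:E)%E.
  under eq_integral do rewrite EFinD.
  rewrite ge0_integralD//.
  - rewrite icst [RHS]EFinD; congr (_ + _)%E.
    under eq_integral do rewrite EFinM.
    rewrite ge0_integralZl//.
    + by rewrite integral_LT.
    + exact/measurable_EFinP.
    + by move=> w _; rewrite lee_fin.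
  - by move=> w _; rewrite lee_fin mulr_ge0// ltW.
  - by move=> w _; rewrite lee_fin mulr_ge0// L_ge0.
  - by apply/measurable_EFinP; exact: measurable_funM.
have -> : (\int[P0]_w ((2 * eta * \1_S1 w) + (2 * eta * (L A w * \1_S0 w) +
      (L A w ^+ 2 + (1 + eta ^+ 2))))%:E =
    (2 * eta)%:E * a + ((2 * eta)%:E * c +
      (config_energy A + (1 + eta ^+ 2))%:E))%E.
  have eta2 : 0 <= 2 * eta by rewrite mulr_ge0// ltW.
  have L2 w : 0 <= L A w ^+ 2 by exact: sqr_ge0.
  have c1 : 0 <= 1 + eta ^+ 2 by rewrite addr_ge0// sqr_ge0.
  have LS w : 0 <= L A w * \1_S0 w by rewrite mulr_ge0 ?L_ge0.
  have mL2 : measurable_fun setT (fun w => L A w ^+ 2).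
    exact: measurable_funX.
  have mLS : measurable_fun setT (fun w => L A w * \1_S0 w).
    exact: measurable_funM.
  under eq_integral do rewrite EFinD.
  rewrite ge0_integralD//.
  - congr (_ + _)%E.
      under eq_integral do rewrite EFinM.
      rewrite ge0_integralZl//.
      + by rewrite integral_indic// setIT.
      + exact/measurable_EFinP.
    under eq_integral do rewrite EFinD.
    rewrite ge0_integralD//.
    + congr (_ + _)%E.
        under eq_integral do rewrite EFinM.
        rewrite ge0_integralZl//.
        * congr (_ * _)%E; rewrite /c [RHS]integral_mkcond.
          by apply: eq_integral => w _; rewrite epatch_indic EFinM.
        * exact/measurable_EFinP.
        * by move=> w _; rewrite lee_fin.
      under eq_integral do rewrite EFinD.
      rewrite ge0_integralD//.
      * by rewrite integral_L2 icst.
      * by move=> w _; rewrite lee_fin.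
      * exact/measurable_EFinP.
    + by move=> w _; rewrite lee_fin mulr_ge0.
    + by apply/measurable_EFinP; exact: measurable_funM.
    + by move=> w _; rewrite lee_fin addr_ge0.
    + by apply/measurable_EFinP; exact: measurable_funD.
  - by move=> w _; rewrite lee_fin mulr_ge0.
  - by apply/measurable_EFinP; exact: measurable_funM.
  - move=> w _; rewrite lee_fin.
    by apply: addr_ge0; [exact: mulr_ge0|exact: addr_ge0].
  - apply/measurable_EFinP.
    by apply: measurable_funD; [exact: measurable_funM|exact: measurable_funD].
rewrite -(fineK afin) -(fineK bfin) -(fineK cfin) -!EFinM -!EFinD !lee_fin => H.
have cb' : fine c <= fine b by exact: fine_le.
(* By [energy_le], the energy plus 1 is at most [eta ^+ 2] plus twice the mass; the mass cancels in
   [H], and [c] is then replaced by the larger [b]. *)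
have : 2 * eta * (1 - eta) <= 2 * eta * (fine a + fine b).
  have : 2 * eta * fine c <= 2 * eta * fine b by rewrite ler_pM2l// mulr_gt0.
  nra.
by rewrite ler_pM2l// mulr_gt0.
Qed.

End testing_lower_bound.

(** * Elementary bounds on the hyperbolic cosine *)

Section hyperbolic_cosine.
Context (R : realType).
Implicit Types x y : R.

Definition cosh x : R := (expR x + expR (- x)) / 2.

Lemma cosh_ge0 x : 0 <= cosh x.
Proof. by rewrite divr_ge0// addr_ge0// expR_ge0. Qed.

Lemma cosh_le_expR x : 0 <= x -> cosh x <= expR x.
Proof.
move=> x0; have : expR (- x) <= expR x by rewrite ler_expR; lra.
by rewrite /cosh; lra.
Qed.

Lemma expR_le_invB1 y : y < 1 -> expR y <= (1 - y)^-1.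
Proof.
move=> y1; rewrite -[expR y]invrK -expRN lef_pV2 ?posrE ?expR_gt0 ?subr_gt0//.
by have := expR_ge1Dx (- y); lra.
Qed.

(** For [x] at least 1/2, already [x <= 2 * x ^+ 2]. Below 1/2, averaging the bounds [(1 - x)^-1]
    and [(1 + x)^-1] gives [(1 - x ^+ 2)^-1], which is at most [1 + 2 * x ^+ 2]. The constant 2 is
    not sharp, but the exponents it enters tend to 0 or are assumed small. *)
Lemma cosh_le_expR_sqr x : 0 <= x -> cosh x <= expR (2 * x ^+ 2).
Proof.
move=> x0; have [x2|x2] := leP (2^-1) x.
  apply: le_trans (cosh_le_expR x0) _; rewrite ler_expR; nra.
set y := x ^+ 2.
have y1 : y <= 4^-1 by rewrite /y; nra.
have y0 : 0 <= y by exact: sqr_ge0.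
have h1 : expR x <= (1 - x)^-1 by apply: expR_le_invB1; lra.
have h2 : expR (- x) <= (1 + x)^-1.
  by rewrite -{2}[x]opprK; apply: expR_le_invB1; lra.
have h3 : cosh x <= (1 - y)^-1.
  have -> : (1 - y)^-1 = ((1 - x)^-1 + (1 + x)^-1) / 2.
    by rewrite /y; field; rewrite !gt_eqF//=; nra.
  by rewrite /cosh; lra.
apply: le_trans h3 _.
apply: (@le_trans _ _ (1 + 2 * y)); last exact: expR_ge1Dx.
by rewrite -[leLHS]mul1r ler_pdivrMr; nra.
Qed.

End hyperbolic_cosine.

(** * The second moment *)

Section second_moment.
Context (R : realType) (n p : nat) (eps tau : R).
Hypothesis eps01 : 0 <= eps <= 1.
Local Notation supp := {ffun 'I_p -> bool}.
Implicit Types (v : supp) (A : pred supp).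

Definition overlap v v' : R := \sum_j (v j && v' j)%:R.

Definition support_size v : R := \sum_j (v j)%:R.

Lemma overlap_ge0 v v' : 0 <= overlap v v'.
Proof. exact: sumr_ge0. Qed.

Lemma overlap_le v v' : overlap v v' <= support_size v.
Proof.
by apply: ler_sum => j _; rewrite ler_nat; case: (v j); case: (v' j).
Qed.

Lemma support_weight_ge0 v : 0 <= support_weight eps v.
Proof.
apply: prodr_ge0 => j _.
by have /andP[e0 e1] := eps01; case: ifP => _; rewrite ?subr_ge0.
Qed.

Lemma sum_prod_ffun_bool (I : finType) (f : I -> bool -> R) :
  \sum_(v : {ffun I -> bool}) \prod_i f i (v i) =
  \prod_i (f i true + f i false).
Proof.
rewrite -bigA_distr_bigA; apply: eq_bigr => i _.
by rewrite -big_bool.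
Qed.

Lemma sum_support_weight : \sum_(v : supp) support_weight eps v = 1.
Proof.
rewrite /support_weight.
rewrite (sum_prod_ffun_bool (fun _ b => if b then eps else 1 - eps)).
by apply: big1 => j _; ring.
Qed.

(** The moment generating function of the binomial law with parameters [p] and [eps]. *)
Lemma support_weight_expR (t : R) :
  \sum_(v : supp) support_weight eps v * expR (t * support_size v) =
  (1 + eps * (expR t - 1)) ^+ p.
Proof.
rewrite -[X in _ ^+ X]card_ord -prodr_const.
pose f (_ : 'I_p) b := (if b then eps else 1 - eps) * expR (t * b%:R).
transitivity (\sum_(v : supp) \prod_j f j (v j)).
  apply: eq_bigr => v _; rewrite /support_size mulr_sumr expR_sum -big_split/=.
  exact: eq_bigr.
rewrite sum_prod_ffun_bool; apply: eq_bigr => j _.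
by rewrite /f mulr1 mulr0 expR0; ring.
Qed.

(** A coordinate lies in both supports with probability [eps ^+ 2], so the overlap of two
    independent supports is binomial with parameters [p] and [eps ^+ 2]. *)
Lemma support_weight_expR_overlap (t : R) :
  \sum_(v : supp) \sum_(v' : supp)
    support_weight eps v * support_weight eps v' * expR (t * overlap v v') =
  (1 + eps ^+ 2 * (expR t - 1)) ^+ p.
Proof.
rewrite -[X in _ ^+ X]card_ord -prodr_const.
pose wt (b : bool) := if b then eps else 1 - eps.
pose f (_ : 'I_p) b b' := wt b * wt b' * expR (t * (b && b')%:R).
transitivity (\sum_(v : supp) \prod_j (f j (v j) true + f j (v j) false)).
  apply: eq_bigr => v _; rewrite -(sum_prod_ffun_bool (fun j => f j (v j))).
  apply: eq_bigr => v' _.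
  by rewrite /overlap mulr_sumr expR_sum -!big_split.
rewrite (sum_prod_ffun_bool (fun j b => f j b true + f j b false)).
apply: eq_bigr => j _.
by rewrite /f /wt /= mulr1 mulr0 expR0; ring.
Qed.

Lemma expr_1D_le (x : R) (k : nat) :
  0 <= 1 + x -> (1 + x) ^+ k <= expR (k%:R * x).
Proof.
move=> x0; rewrite expRM_natl.
by apply: lerXn2r; rewrite ?nnegrE ?expR_ge0// expR_ge1Dx.
Qed.

Lemma config_massE A :
  config_mass n eps A = \sum_(v | A v) support_weight eps v.
Proof.
rewrite /config_mass.
rewrite (eq_bigl
  (fun sv : {ffun 'I_n -> bool} * supp => predT sv.1 && A sv.2))//.
rewrite -(pair_big predT A (fun s v => arw_weight eps (s, v)))/=.
rewrite exchange_big/=; apply: eq_bigr => v _.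
rewrite /arw_weight/= -mulr_suml.
rewrite sumr_const card_ffun card_bool card_ord.
by rewrite -[_ *+ _]mulr_natl natrX -exprMn mulfV// expr1n mul1r.
Qed.

(** In each row the product of the two labels is a uniform sign; averaging the exponential over it
    gives one factor [cosh] per row. *)
Lemma config_energyE A :
  config_energy n eps tau A = \sum_(v | A v) \sum_(v' | A v')
    support_weight eps v * support_weight eps v' *
    cosh (tau ^+ 2 * overlap v v') ^+ n.
Proof.
rewrite /config_energy.
pose e (s : {ffun 'I_n -> bool}) (v : supp)
    (s' : {ffun 'I_n -> bool}) (v' : supp) :=
  arw_weight eps (s, v) * arw_weight eps (s', v') *
  expR (\sum_k arw_shift tau (s, v) k * arw_shift tau (s', v') k).
transitivity (\sum_s \sum_(v | A v) \sum_s' \sum_(v' | A v') e s v s' v').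
  rewrite (pair_big predT A
    (fun s v => \sum_s' \sum_(v' | A v') e s v s' v'))/=.
  apply: eq_bigr => -[s v] _.
  rewrite (pair_big predT A (fun s' v' => e s v s' v')).
  by apply: eq_bigr => -[].
rewrite exchange_big/=; apply: eq_bigr => v _.
under eq_bigr do rewrite exchange_big/=.
rewrite exchange_big/=; apply: eq_bigr => v' _.
pose x := tau ^+ 2 * overlap v v'.
(* The contribution of one row whose labels in the two configurations are [b] and [b']. *)
pose f (_ : 'I_n) b b' := 2^-1 * 2^-1 * expR (label R b * label R b' * x).
transitivity (\sum_(s : {ffun 'I_n -> bool}) \sum_(s' : {ffun 'I_n -> bool})
    support_weight eps v * support_weight eps v' * \prod_i f i (s i) (s' i)).
  apply: eq_bigr => s _; apply: eq_bigr => s' _.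
  rewrite /e /arw_weight/= /f !big_split/= !prodr_const card_ord.
  rewrite -expR_sum.
  have -> : \sum_k arw_shift tau (s, v) k * arw_shift tau (s', v') k =
      \sum_i label R (s i) * label R (s' i) * x.
    rewrite -(pair_big predT predT (fun i j =>
      arw_shift tau (s, v) (i, j) * arw_shift tau (s', v') (i, j)))/=.
    apply: eq_bigr => i _; rewrite /x /overlap !mulr_sumr.
    apply: eq_bigr => j _.
    by rewrite /arw_shift/=; case: (v j); case: (v' j) => /=; ring.
  by ring.
under eq_bigr do rewrite -mulr_sumr.
rewrite -mulr_sumr; congr (_ * _).
under eq_bigr => s _ do rewrite (sum_prod_ffun_bool (fun i => f i (s i))).
rewrite (sum_prod_ffun_bool (fun i b => f i b true + f i b false)).
rewrite /f prodr_const card_ord; congr (_ ^+ _).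
by rewrite /label /cosh -/x !mulrN !mulNr !mul1r opprK; field.
Qed.

(* Chernoff's bound for the binomial support size. *)
Lemma config_mass_ge (K : R) :
  1 - expR (p%:R * eps * (expR 1 - 1) - K) <=
  config_mass n eps (fun v => support_size v <= K).
Proof.
have /andP[e0 e1] := eps01.
rewrite config_massE -[X in X - _]sum_support_weight.
rewrite (bigID (fun v => support_size v <= K))/= lerBlDr lerD2l.
have -> : expR (p%:R * eps * (expR 1 - 1) - K) =
    expR (- K) * expR (p%:R * (eps * (expR 1 - 1))).
  by rewrite -expRD; congr expR; ring.
have e11 : 0 <= expR 1 - 1 :> R by rewrite subr_ge0 -expR0 ler_expR.
apply: (@le_trans _ _ (expR (- K) * (1 + eps * (expR 1 - 1)) ^+ p)); last first.
  rewrite ler_wpM2l ?expR_ge0// expr_1D_le// addr_ge0// mulr_ge0//.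
rewrite -support_weight_expR mulr_sumr.
rewrite [leRHS](bigID (fun v => support_size v <= K))/= -[leLHS]add0r.
apply: lerD.
  apply: sumr_ge0 => v _.
  by rewrite mulr_ge0 ?expR_ge0// mulr_ge0 ?expR_ge0 ?support_weight_ge0.
(* Beyond the cutoff the factor [expR (support_size v - K)] is at least 1. *)
apply: ler_sum => v; rewrite -ltNge => Kv.
rewrite mulrCA -expRD ler_peMr ?support_weight_ge0//.
by rewrite -[leLHS]expR0 ler_expR; lra.
Qed.

(* On the truncation event the overlap [b] is at most [K], so either smallness
   assumption gives [cosh (tau ^+ 2 * b) ^+ n <= expR b]. This is used only
   for [b > M], where [expR b <= expR (2 * b - M)]; for [b <= M] the Gaussian
   bound [cosh x <= expR (2 * x ^+ 2)] suffices. *)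
Lemma config_energy_le (K M : R) : 0 <= M ->
  n%:R * tau ^+ 2 <= 1 \/ 2 * n%:R * tau ^+ 4 * K <= 1 ->
  config_energy n eps tau (fun v => support_size v <= K) <=
  expR (2 * n%:R * tau ^+ 4 * M ^+ 2) +
  expR (p%:R * eps ^+ 2 * (expR 2 - 1) - M).
Proof.
move=> M0 small; rewrite config_energyE.
have /andP[e0 e1] := eps01.
(* Adding the bounds of the two regimes gives one estimate for every overlap, whose expectation is
   explicit. *)
have coshn v v' : support_size v <= K ->
    cosh (tau ^+ 2 * overlap v v') ^+ n <=
    expR (2 * n%:R * tau ^+ 4 * M ^+ 2) +
    expR (- M) * expR (2 * overlap v v').
  move=> vK; set b := overlap v v'.
  have b0 : 0 <= b := overlap_ge0 v v'.
  have bK : b <= K := le_trans (overlap_le v v') vK.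
  have tb0 : 0 <= tau ^+ 2 * b by rewrite mulr_ge0 ?sqr_ge0.
  have sqr_bound : cosh (tau ^+ 2 * b) ^+ n <=
      expR (2 * n%:R * tau ^+ 4 * b ^+ 2).
    apply: (@le_trans _ _ (expR (2 * (tau ^+ 2 * b) ^+ 2) ^+ n)).
      by apply: lerXn2r; rewrite ?nnegrE ?cosh_ge0 ?expR_ge0 ?cosh_le_expR_sqr.
    by rewrite -expRM_natl ler_expR; lra.
  have t4 : 0 <= tau ^+ 4 by rewrite exprn_even_ge0.
  have nt4 : 0 <= 2 * n%:R * tau ^+ 4 by apply: mulr_ge0 => //; exact: mulr_ge0.
  have [bM|Mb] := leP b M.
    apply: le_trans sqr_bound _; rewrite -[leLHS]addr0.
    apply: lerD; last by rewrite mulr_ge0 ?expR_ge0.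
    by rewrite ler_expR ler_wpM2l// ler_sqr ?nnegrE.
  apply: (@le_trans _ _ (expR b)).
    case: small => small.
      apply: (@le_trans _ _ (expR (tau ^+ 2 * b) ^+ n)).
        by apply: lerXn2r; rewrite ?nnegrE ?cosh_ge0 ?expR_ge0 ?cosh_le_expR.
      by rewrite -expRM_natl ler_expR mulrA ler_piMl.
    apply: le_trans sqr_bound _; rewrite ler_expR.
    (* One factor [b] is bounded by [K], which leaves an exponent at most [b]. *)
    rewrite expr2 mulrA ler_piMl//; apply: le_trans small.
    exact: ler_wpM2l.
  rewrite -expRD -[leLHS]add0r; apply: lerD; first exact: expR_ge0.
  by rewrite ler_expR; lra.
apply: (@le_trans _ _ (\sum_(v : supp) \sum_(v' : supp) support_weight eps v *
    support_weight eps v' * (expR (2 * n%:R * tau ^+ 4 * M ^+ 2) +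
    expR (- M) * expR (2 * overlap v v')))).
  have w0 v v' : 0 <= support_weight eps v * support_weight eps v'.
    by rewrite mulr_ge0 ?support_weight_ge0.
  have t0 v v' : 0 <= support_weight eps v * support_weight eps v' *
      (expR (2 * n%:R * tau ^+ 4 * M ^+ 2) +
       expR (- M) * expR (2 * overlap v v')).
    by rewrite mulr_ge0// addr_ge0 ?mulr_ge0 ?expR_ge0.
  rewrite [leRHS](bigID (fun v => support_size v <= K))/= -[leLHS]addr0.
  apply: lerD; last by apply: sumr_ge0 => v _; apply: sumr_ge0.
  apply: ler_sum => v vK.
  rewrite [leRHS](bigID (fun v => support_size v <= K))/= -[leLHS]addr0.
  apply: lerD; last by apply: sumr_ge0.
  by apply: ler_sum => v' _; rewrite ler_wpM2l// coshn.
under eq_bigr => v _.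
  under eq_bigr do rewrite mulrDr.
  rewrite big_split/= -mulr_suml -mulr_sumr sum_support_weight mulr1.
  over.
rewrite big_split/= -mulr_suml sum_support_weight mul1r lerD2l.
under eq_bigr => v _.
  under eq_bigr do rewrite mulrCA.
  rewrite -mulr_sumr.
  over.
rewrite -mulr_sumr support_weight_expR_overlap [_ - M]addrC.
rewrite [leRHS]expRD ler_wpM2l ?expR_ge0// -mulrA; apply: expr_1D_le.
have : 1 <= expR 2 :> R by rewrite -[leLHS]expR0 ler_expR.
by move=> e2; rewrite addr_ge0// mulr_ge0 ?sqr_ge0 ?subr_ge0.
Qed.

End second_moment.

(** The tail infima of [v] converge to [l] and are eventually below those of [u]. *)
Lemma limn_einf_ge (R : realType) (u : (\bar R)^nat) (v : R^nat) (l : R) :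
  v @ \oo --> l -> (\forall k \near \oo, ((v k)%:E <= u k)%E) ->
  (l%:E <= limn_einf u)%E.
Proof.
move=> vl vu; have vlE : (EFin \o v) @ \oo --> l%:E.
  by apply: cvg_comp vl _.
rewrite limn_einf_lim -(cvg_lim _ (cvg_einfs vlE))//.
apply: lee_lim; [exact: is_cvg_einfs|exact: is_cvg_einfs|].
case: vu => N _ vu; exists N => // m /= Nm.
apply: le_ereal_inf_tmp => _ [k /= mk <-].
apply: le_trans (vu k (leq_trans Nm mk)).
by apply: ereal_inf_lbound; exists k.
Qed.

(** * Asymptotics *)

Section power_limits.
Context (R : realType).
Implicit Types a b : R.

Lemma cvgn_powR_pinfty b : 0 < b -> (k%:R `^ b : R) @[k --> \oo] --> +oo.
Proof.
move=> b0; apply/cvgryPge => A.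
near=> k.
have A1 : A <= Num.max A 1 by rewrite le_max lexx.
(* The maximum with 1 is nonnegative even when [A] is not, hence a [b]-th power. *)
apply: (le_trans A1).
have m0 : 0 <= Num.max A 1 by rewrite le_max ler01 orbT.
have -> : Num.max A 1 = (Num.max A 1 `^ b^-1) `^ b.
  by rewrite -powRrM mulVf ?gt_eqF// powRr1.
apply: ge0_ler_powR; rewrite ?nnegrE ?powR_ge0//; first exact: ltW.
near: k; exact: nbhs_infty_ger.
Unshelve. all: by end_near. Qed.

Lemma cvgn_powR_0 a : a < 0 -> (k%:R `^ a : R) @[k --> \oo] --> (0 : R).
Proof.
move=> a0; have Na0 : 0 < - a by rewrite oppr_gt0.
rewrite (_ : (fun k => _) = (fun k : nat => (k%:R `^ (- a) : R)^-1));
  last first.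
  by apply/funext => k /=; rewrite powRN invrK.
apply: (iffRL (gtr0_cvgV0 (f := fun k : nat => k%:R `^ (- a) : R) _)).
  near=> k; apply: powR_gt0; rewrite ltr0n; near: k; exact: nbhs_infty_gt.
exact: cvgn_powR_pinfty.
Unshelve. all: by end_near. Qed.

Lemma cvgn_expRN_powR b : 0 < b ->
  (expR (- k%:R `^ b) : R) @[k --> \oo] --> (0 : R).
Proof.
move=> b0; apply: (cvg_comp (fun k : nat => k%:R `^ b) (fun x => expR (- x))).
  exact: cvgn_powR_pinfty.
exact: cvgr_expR.
Qed.

End power_limits.

Section asymptotics.
Context (R : realType) (alpha beta theta : R).
Hypotheses (beta01 : 0 < beta < 1) (theta01 : 0 < theta < 1).
Hypothesis alpha_gt : eta_hyp theta beta < alpha.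
Local Notation e2 := (expR 2 : R).

(** Chosen so that [theta - 4 * alpha + 2 * gamma = - 2 * gamma]: both n tau^4 p^(2 gamma) and exp(-
    p^gamma) tend to 0 as soon as [gamma] is positive. *)
Let gamma : R := (4 * alpha - theta) / 4.

(** The exponent in p of n tau^4 (p eps^2)^2. *)
Let subcritical1 : theta - 4 * alpha + (2 - 4 * beta) < 0.
Proof.
move: alpha_gt; rewrite /eta_hyp gt_max /eta_hyp1 => /andP[+ _]; lra.
Qed.

(** The two cases make n tau^2, respectively n tau^4 p eps, a negative power of p. *)
Let subcritical2 : theta < 2 * alpha \/ theta - 4 * alpha + (1 - beta) < 0.
Proof.
move: alpha_gt; rewrite /eta_hyp gt_max /eta_hyp2 gt_min => /andP[_ /orP[]] h.
  by left; lra.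
by right; lra.
Qed.

Let gamma_gt0 : 0 < gamma.
Proof.
have /andP[? ?] := beta01; have /andP[? ?] := theta01.
by rewrite divr_gt0//; case: subcritical2; lra.
Qed.

(* Bounds [2 n tau^4 M^2] for [M = e^2 p eps^2 + p^gamma]. *)
Definition overlap_exponent (p : nat) : R :=
  4 * e2 ^+ 2 * p%:R `^ (theta - 4 * alpha + (2 - 4 * beta)) +
  4 * p%:R `^ (theta - 4 * alpha + 2 * gamma).

(** Bounds E L^2 - 2 E L + 1: the two terms of the energy bound, and twice the mass lost by
    truncation. *)
Definition chi2_bound (p : nat) : R :=
  expR (overlap_exponent p) - 1 + expR (- p%:R `^ gamma) +
  2 * expR (- p%:R `^ (1 - beta)).

Lemma cvg_chi2_bound : chi2_bound @ \oo --> (0 : R).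
Proof.
have /andP[? ?] := beta01.
have u0 : overlap_exponent @ \oo --> (0 : R).
  have g0 : theta - 4 * alpha + 2 * gamma < 0.
    by move: gamma_gt0; rewrite /gamma; lra.
  rewrite [X in _ --> X](_ : 0 = 4 * e2 ^+ 2 * 0 + 4 * 0); last by ring.
  by apply: cvgD; (apply: cvgM; [exact: cvg_cst|exact: cvgn_powR_0]).
rewrite [X in _ --> X](_ : 0 = 1 - 1 + 0 + 2 * 0); last by ring.
apply: cvgD; last first.
  by apply: cvgM; [exact: cvg_cst|apply: cvgn_expRN_powR; lra].
apply: cvgD; last exact: cvgn_expRN_powR.
apply: cvgB; last exact: cvg_cst.
rewrite -[X in _ --> X]expR0.
exact: (cvg_comp overlap_exponent expR u0 (@continuous_expR R 0)).
Qed.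

(** Makes the square root of the bound an admissible [eta > 0] in [testing_error_ge]. *)
Lemma chi2_bound_gt0 (p : nat) : 0 < chi2_bound p.
Proof.
have h : 1 <= expR (overlap_exponent p).
  rewrite -[leLHS]expR0 ler_expR.
  by apply: addr_ge0; rewrite mulr_ge0 ?powR_ge0// mulr_ge0 ?sqr_ge0.
have := expR_gt0 (- p%:R `^ gamma : R).
have := expR_gt0 (- p%:R `^ (1 - beta) : R).
by rewrite /chi2_bound; lra.
Qed.

(** An upper bound for 2 n tau^4 K, with K the support cutoff. *)
Let small (p : nat) : R :=
  2 * expR 1 * p%:R `^ (theta - 4 * alpha + (1 - beta)).

(** With the factor e the Chernoff exponent p eps (e - 1) - K is exactly - p eps. *)
Definition support_cutoff (p : nat) : R := expR 1 * (p%:R * sparsity beta p).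

Lemma energy_mass_le (p : nat) (n := sample_size theta p)
    (eps := sparsity beta p) (A := fun v : {ffun 'I_p -> bool} =>
       support_size R v <= support_cutoff p) :
  (0 < p)%N -> theta < 2 * alpha \/ small p <= 1 ->
  config_energy n eps (strength alpha p) A - 2 * config_mass n eps A + 1 <=
  chi2_bound p.
Proof.
move=> p0 small_p.
set x : R := p%:R; have x0 : 0 < x by rewrite ltr0n.
have x1 : 1 <= x by rewrite ler1n.
have hD a b : x `^ (a + b) = x `^ a * x `^ b.
  by rewrite powRD// (gt_eqF x0) implybT.
have hX a k : (x `^ a) ^+ k = x `^ (a * k%:R).
  by rewrite powRrM powR_mulrn// powR_ge0.
have h1 : x `^ 1 = x by rewrite powRr1// ltW.
have /andP[b0 b1] := beta01.
have eps01 : 0 <= eps <= 1.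
  rewrite /eps /sparsity powR_ge0/= -[leRHS](powRr0 x).
  by apply: ler_powR => //; lra.
(* Rounding down is harmless: the estimates need [n] from above only. *)
have nle : n%:R <= x `^ theta.
  by rewrite /n /sample_size truncn_le powR_ge0.
have t2 : strength alpha p ^+ 2 = x `^ (- 2 * alpha).
  by rewrite hX; congr (_ `^ _); ring.
have t4 : strength alpha p ^+ 4 = x `^ (- 4 * alpha).
  by rewrite hX; congr (_ `^ _); ring.
have pe : x * eps = x `^ (1 - beta) by rewrite hD h1.
have pe2 : x * eps ^+ 2 = x `^ (1 - 2 * beta).
  by rewrite hX -{1}h1 -hD; congr (_ `^ _); ring.
(* The first term absorbs the exponent p eps^2 (e^2 - 1) of the overlap; what is left is at most -
   p^gamma. *)
pose M := e2 * (x * eps ^+ 2) + x `^ gamma.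
have M0 : 0 <= M.
  by rewrite addr_ge0 ?powR_ge0// mulr_ge0 ?expR_ge0// pe2 powR_ge0.
have n0 : 0 <= n%:R :> R by [].
have cases : n%:R * strength alpha p ^+ 2 <= 1 \/
    2 * n%:R * strength alpha p ^+ 4 * support_cutoff p <= 1.
  case: small_p => [h|h]; [left|right].
    apply: (@le_trans _ _ (x `^ theta * x `^ (- 2 * alpha))).
      by rewrite t2 ler_wpM2r ?powR_ge0.
    by rewrite -hD -[leRHS](powRr0 x) ler_powR//; lra.
  apply: le_trans h; rewrite t4 /support_cutoff -/x -/eps pe /small -/x.
  have -> : x `^ (theta - 4 * alpha + (1 - beta)) =
      x `^ theta * x `^ (- 4 * alpha) * x `^ (1 - beta).
    by rewrite -!hD; congr (_ `^ _); ring.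
  have -> : 2 * n%:R * x `^ (- 4 * alpha) * (expR 1 * x `^ (1 - beta)) =
     n%:R * (2 * expR 1 * (x `^ (- 4 * alpha) * x `^ (1 - beta))) by ring.
  have -> : 2 * expR 1 * (x `^ theta * x `^ (- 4 * alpha) * x `^ (1 - beta)) =
     x `^ theta * (2 * expR 1 * (x `^ (- 4 * alpha) * x `^ (1 - beta))) by ring.
  rewrite ler_wpM2r//.
  by apply: mulr_ge0; rewrite mulr_ge0 ?powR_ge0 ?expR_ge0.
have energy :=
  @config_energy_le R n p eps (strength alpha p) eps01 _ M M0 cases.
have mass := @config_mass_ge R n p eps eps01 (support_cutoff p).
have E1 : x * eps * (expR 1 - 1) - support_cutoff p = - x `^ (1 - beta).
  by rewrite /support_cutoff -/x -/eps -pe; ring.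
have E2 : expR (x * eps ^+ 2 * (e2 - 1) - M) <= expR (- x `^ gamma).
  rewrite ler_expR /M; have : 0 <= x * eps ^+ 2 by rewrite pe2 powR_ge0.
  lra.
have E3 : expR (2 * n%:R * strength alpha p ^+ 4 * M ^+ 2) <=
    expR (overlap_exponent p).
  rewrite ler_expR t4.
  apply: (@le_trans _ _ (2 * x `^ theta * x `^ (- 4 * alpha) * M ^+ 2)).
    by rewrite ler_wpM2r ?sqr_ge0// ler_wpM2r ?powR_ge0// ler_wpM2l.
  have M2 : M ^+ 2 <=
      2 * (e2 ^+ 2 * x `^ (2 - 4 * beta)) + 2 * x `^ (2 * gamma).
    have -> : x `^ (2 - 4 * beta) = (x * eps ^+ 2) ^+ 2.
      by rewrite pe2 hX; congr (_ `^ _); ring.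
    have -> : x `^ (2 * gamma) = (x `^ gamma) ^+ 2 by rewrite hX mulrC.
    rewrite /M; have := sqr_ge0 (e2 * (x * eps ^+ 2) - x `^ gamma).
    by rewrite -exprMn; nra.
  have w0 : 0 <= 2 * x `^ theta * x `^ (- 4 * alpha).
    by rewrite mulr_ge0 ?powR_ge0// mulr_ge0 ?powR_ge0.
  apply: le_trans (ler_wpM2l w0 M2) _.
  rewrite /overlap_exponent -/x !(hD (theta - 4 * alpha)).
  have -> : theta - 4 * alpha = theta + - 4 * alpha by ring.
  by rewrite hD le_eqVlt; apply/orP; left; apply/eqP; ring.
rewrite /chi2_bound -/x.
rewrite -/x E1 in mass.
rewrite -/x in energy.
move: energy mass E2 E3; rewrite -/A -/n; lra.
Qed.

Lemma eventually_energy_mass_le : \forall p \near \oo,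
  (0 < p)%N /\
  (let n := sample_size theta p in let eps := sparsity beta p in
   let A := fun v : {ffun 'I_p -> bool} =>
     support_size R v <= support_cutoff p in
   config_energy n eps (strength alpha p) A - 2 * config_mass n eps A + 1 <=
   chi2_bound p).
Proof.
have small_near : \forall p \near \oo, theta < 2 * alpha \/ small p <= 1.
  case: subcritical2 => h; first by near=> p; left.
  have s0 : small @ \oo --> (0 : R).
    rewrite -(mulr0 (2 * expR 1)); apply: cvgM; first exact: cvg_cst.
    exact: cvgn_powR_0.
  near=> p; right; apply: ltW; near: p.
  exact: (cvgr_lt _ s0 _ ltr01).
near=> p.
have p0 : (0 < p)%N by near: p; exact: nbhs_infty_gt.
split=> //; apply: energy_mass_le => //; near: p; exact: small_near.
Unshelve. all: by end_near. Qed.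

End asymptotics.

Theorem theorem4p1 (R : realType) (alpha beta theta : R)
  (alpha01 : 0 < alpha < 1) (beta01 : 0 < beta < 1) (theta01 : 0 < theta < 1)
  (alpha_gt : eta_hyp theta beta < alpha)
  (d0 : nat -> measure_display) (Om0 : forall p, measurableType (d0 p))
  (P0 : forall p, probability (Om0 p) R)
  (X : forall p, 'I_(sample_size theta p) -> 'I_p -> {RV (P0 p) >-> R})
  (H0 : forall p, iid_std_normal_rows (X p))
  (d1 : nat -> measure_display) (Om1 : forall p, measurableType (d1 p))
  (P1 : forall p, probability (Om1 p) R)
  (ell : forall p, 'I_(sample_size theta p) -> {RV (P1 p) >-> R})
  (mu : forall p, 'I_p -> {RV (P1 p) >-> R})
  (Z : forall p, 'I_(sample_size theta p) -> 'I_p -> {RV (P1 p) >-> R})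
  (H1 : forall p,
     ARW_model (sparsity beta p) (strength alpha p) (ell p) (mu p) (Z p))
  (T : forall p, {mfun dataset R (sample_size theta p) p >-> bool}) :
  (1 <= limn_einf (fun p =>
          testing_error (P0 p) (data_of (X p))
                        (P1 p) (ARW_data (ell p) (mu p) (Z p)) (T p)))%E.
Proof.
pose r := chi2_bound alpha beta theta.
(* Taking [eta] to be the square root of [r p] meets the second moment condition for large p, and
   this [eta] tends to 0. *)
apply: (limn_einf_ge (v := fun p => 1 - Num.sqrt (r p))).
  rewrite [X in _ --> X](_ : 1 = 1 - Num.sqrt 0); last by rewrite sqrtr0 subr0.
  apply: cvgB; first exact: cvg_cst.
  apply: (cvg_comp r Num.sqrt); last exact: sqrt_continuous.
  exact: cvg_chi2_bound.
have [N _ HN] := eventually_energy_mass_le beta01 alpha_gt.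
exists N => // p Np; have [p0 bound] := HN p Np.
have x0 : 0 < p%:R :> R by rewrite ltr0n.
apply: (testing_error_ge (H0 p) (H1 p) _ (T p)
  (A := fun v => support_size R v <= support_cutoff beta p)).
- by rewrite gt_eqF// powR_gt0.
- by rewrite sqrtr_gt0; exact: chi2_bound_gt0.
- by rewrite sqr_sqrtr; [exact: bound|exact/ltW/chi2_bound_gt0].
Qed.
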